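(* Let $B$ denote the closed unit ball in $\mathbb{R}^d$. If $f$ is a measurable function satisfying $f\in L\log\log L(B)$ and $\int_B f(y)\,dy=0$, then $f\in H^{\log}(\mathbb{R}^d)$.
   Context: $\log^+ t:=\max\{\log t,0\}$ for $t>0$ and $\log^+0:=0$. $L\log\log L(B)$ is the class of all locally integrable functions $f$ with $\mathrm{supp}(f)\subseteq B$ and $\int_B|f(x)|\log^+\log^+|f(x)|\,dx<\infty$. $\Psi(x,t):=\dfrac{t}{\log(e+t)+\log(e+|x|)}$ for $(x,t)\in\mathbb{R}^d\times[0,\infty)$. Fix a non-negative $\phi\in C^\infty(\mathbb{R}^d)$ supported in the unit ball of $\mathbb{R}^d$ with $\int_{\mathbb{R}^d}\phi=1$ and $\phi(x)=c_d$ for all $|x|\le 1/2$, where $c_d$ is a constant depending on $d$. For $\epsilon>0$ put $\phi_\epsilon(x):=\epsilon^{-d}\phi(\epsilon^{-1}x)$. For a tempered distribution $f$ on $\mathbb{R}^d$ let $M_\phi(f)(x):=\sup_{\epsilon>0}|(f*\phi_\epsilon)(x)|$. The space $H^{\log}(\mathbb{R}^d)$ consists of all tempered distributions $f$ on $\mathbb{R}^d$ with $\int_{\mathbb{R}^d}\Psi(x,M_\phi(f)(x))\,dx<\infty$. Integrable functions are identified with the tempered distributions they define. *)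

(* Defs.v *)
From HB Require Import structures.
From mathcomp Require Import all_boot all_order all_algebra.
From mathcomp Require Import complex.
From mathcomp Require Import all_classical all_reals all_analysis.
From mathcomp Require Import measurable_realfun.

Set Implicit Arguments.
Unset Strict Implicit.
Unset Printing Implicit Defensive.

Import Order.TTheory GRing.Theory Num.Theory.
Import numFieldNormedType.Exports.

Local Open Scope classical_set_scope.
Local Open Scope ring_scope.

(* R^d with d = n.+1 is 'rV[R]_n.+1. Its library norm `|x| is the sup norm,
   whence the separate Euclidean norm below; both give the same topology. *)
Section euclidean_space.
Context {R : realType} {n : nat}.
Implicit Types (x a b : 'rV[R]_n.+1) (A : set 'rV[R]_n.+1).

Definition enorm x : R := Num.sqrt (\sum_i x 0 i ^+ 2).

Definition unit_ball : set 'rV[R]_n.+1 := [set x | enorm x <= 1].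

Definition box (I : 'rV[R]_n.+1 * 'rV[R]_n.+1) : set 'rV[R]_n.+1 :=
  [set x | forall i, I.1 0 i <= x 0 i < I.2 0 i].

Definition vol (I : 'rV[R]_n.+1 * 'rV[R]_n.+1) : R :=
  \prod_i Num.max 0 (I.2 0 i - I.1 0 i).

Definition box_cover A : set (nat -> 'rV[R]_n.+1 * 'rV[R]_n.+1) :=
  [set I | A `<=` \bigcup_k box (I k)].

Definition lebesgue_outer A : \bar R :=
  ereal_inf [set (\sum_(0 <= k <oo) (vol (I k))%:E)%E | I in box_cover A].

Lemma vol_ge0 I : 0 <= vol I.
Proof. by apply: prodr_ge0 => i _; rewrite le_max lexx. Qed.

Lemma lebesgue_outer_ge0 A : (0 <= lebesgue_outer A)%E.
Proof.
apply: le_ereal_inf_tmp => _ [I _ <-].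
by apply: nneseries_ge0 => k _ _; rewrite lee_fin vol_ge0.
Qed.

Lemma le_lebesgue_outer : {homo lebesgue_outer : A B / A `<=` B >-> (A <= B)%E}.
Proof.
move=> A B AB; apply/ereal_inf_le_tmp => _ [I BI <-].
by exists I => //; exact: subset_trans BI.
Qed.

Lemma lebesgue_outer0 : lebesgue_outer set0 = 0%E.
Proof.
apply/eqP; rewrite eq_le lebesgue_outer_ge0 andbT.
apply: ereal_inf_lbound; exists (fun=> (0, 0)); first exact: sub0set.
apply: eseries0 => k _ _.
by rewrite /vol (bigD1 ord0)//= subrr maxxx mul0r.
Qed.

Lemma lebesgue_outer_sigma_subadditive : sigma_subadditive lebesgue_outer.
Proof.
move=> A; have [[i ioo]|] := pselect (exists i, lebesgue_outer (A i) = +oo%E).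
  rewrite (eseries_pinfty _ _ ioo) ?leey// => k _.
  by rewrite -ltNye (lt_le_trans _ (lebesgue_outer_ge0 _)).
rewrite -forallNE => Aoo; apply/lee_addgt0Pr => e e0.
rewrite (le_trans _ (epsilon_trick _ _ (ltW e0)))//; last first.
  by move=> k; exact: lebesgue_outer_ge0.
pose P k I := box_cover (A k) I /\
  (\sum_(0 <= j <oo) (vol (I j))%:E
    <= lebesgue_outer (A k) + (e / (2 ^ k.+1)%:R)%:E)%E.
have [G PG] : {G & forall k, P k (G k)}.
  apply: (@choice _ _ P) => k; rewrite /P.
  have fA : lebesgue_outer (A k) \is a fin_num.
    by rewrite ge0_fin_numE ?lebesgue_outer_ge0// ltey; exact/eqP/Aoo.
  have e2 : 0 < e / (2 ^ k.+1)%:R by rewrite divr_gt0// ltr0n expn_gt0.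
  have [_ [I AI <-] /ltW Ie] := lb_ereal_inf_adherent e2 fA.
  by exists I.
pose v (p : nat * nat) := (vol (G p.1 p.2))%:E.
have v0 p : (0 <= v p)%E by rewrite lee_fin vol_ge0.
apply: (@le_trans _ _ (\esum_(p in setT) v p)).
  apply: ereal_inf_lbound.
  have /card_esym/ppcard_eqP[f] := card_nat2.
  exists (fun k => G (f k).1 (f k).2).
    move=> t [i _ /(PG i).1[j _ tij]].
    by exists (f^-1%FUN (i, j)) => //=; rewrite invK ?inE.
  rewrite nneseries_esumT; last by move=> k; rewrite lee_fin vol_ge0.
  by rewrite (reindex_esum [set: nat] setT f v).
rewrite (_ : esum _ _ =
    \sum_(0 <= i <oo) \sum_(0 <= j <oo) (vol (G i j))%:E)%E; last first.
  rewrite nneseries_esumT; last first.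
    by move=> i; apply: nneseries_ge0 => j _ _; rewrite lee_fin vol_ge0.
  under [RHS]eq_esum.
    move=> i _; rewrite nneseries_esumT; last first.
      by move=> j; rewrite lee_fin vol_ge0.
    over.
  rewrite esum_esum => [|i j _ _]; last by rewrite lee_fin vol_ge0.
  rewrite (_ : [set: nat] `*`` _ = [set: nat * nat])//.
  by apply/seteqP; split=> -[a b].
apply: lee_nneseries => [i _ _|i _]; last exact: (PG i).2.
by apply: nneseries_ge0 => j _ _; rewrite lee_fin vol_ge0.
Qed.

HB.instance Definition _ := isOuterMeasure.Build R 'rV[R]_n.+1 lebesgue_outer
  lebesgue_outer0 lebesgue_outer_ge0 le_lebesgue_outer
  lebesgue_outer_sigma_subadditive.

End euclidean_space.
Arguments unit_ball {R n}.

(* R^d with the sigma-algebra of Lebesgue (i.e. Caratheodory) measurable sets. *)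
Definition lebesgue_space (R : realType) (n : nat) :=
  caratheodory_type (@lebesgue_outer R n).

HB.instance Definition _ (R : realType) (n : nat) :=
  Measurable.on (lebesgue_space R n).


Definition lebesgue (R : realType) (n : nat) : set (lebesgue_space R n) -> \bar R :=
  @lebesgue_outer R n.

HB.instance Definition _ (R : realType) (n : nat) :=
  isMeasure.Build _ _ _ (@lebesgue R n)
    (@caratheodory_measure0 _ _ (@lebesgue_outer R n))
    (@caratheodory_measure_ge0 _ _ (@lebesgue_outer R n))
    (@caratheodory_measure_sigma_additive _ _ (@lebesgue_outer R n)).

Section test_functions.
Context {R : realType} {n : nat}.
Implicit Types (g : 'rV[R]_n.+1 -> R) (psi : 'rV[R]_n.+1 -> R[i]).

(* \partial_(i_1) ... \partial_(i_k) g for s = [:: i_1; ...; i_k]. *)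
Definition partial (s : seq 'I_n.+1) g : 'rV[R]_n.+1 -> R :=
  foldr (fun i h => 'D_(delta_mx 0 i) h) g s.

Definition smooth g : Prop := forall s : seq 'I_n.+1,
  continuous (partial s g) /\
  forall i x, derivable (partial s g) x (delta_mx 0 i).

Definition cpartial (s : seq 'I_n.+1) psi (x : 'rV[R]_n.+1) : R[i] :=
  Complex (partial s (@complex.Re R \o psi) x)
          (partial s (@complex.Im R \o psi) x).

Definition monomial (alpha : 'I_n.+1 -> nat) (x : 'rV[R]_n.+1) : R :=
  \prod_i x 0 i ^+ alpha i.

Definition schwartz_seminorm (alpha : 'I_n.+1 -> nat) (s : seq 'I_n.+1) psi
    : \bar R :=
  ereal_sup [set (`|monomial alpha x| * Normc.normc (cpartial s psi x))%:E
            | x in setT].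

Definition schwartz psi : Prop :=
  [/\ smooth (@complex.Re R \o psi), smooth (@complex.Im R \o psi) &
      forall alpha s, (schwartz_seminorm alpha s psi < +oo)%E].

(* A functional is only meaningful on the Schwartz class; its values elsewhere
   are irrelevant. Continuity is for the topology generated by the seminorms,
   in which the sets below form a neighbourhood basis of psi. *)
Definition schwartz_nbhs psi (N : nat) (delta : R) :
    set ('rV[R]_n.+1 -> R[i]) :=
  [set chi | schwartz chi /\
     forall (alpha : 'I_n.+1 -> nat) (s : seq 'I_n.+1),
       (\sum_i alpha i <= N)%N -> (size s <= N)%N ->
       (schwartz_seminorm alpha s (fun x => (chi x - psi x)%R) < delta%:E)%E].

Definition tempered_distribution (T : ('rV[R]_n.+1 -> R[i]) -> R[i]) : Prop :=
  (forall (a : R[i]) psi chi, schwartz psi -> schwartz chi ->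
     T (fun x => a * psi x + chi x) = a * T psi + T chi) /\
  (forall psi, schwartz psi -> forall e : R, 0 < e ->
     exists N, exists2 delta : R, 0 < delta &
       forall chi, schwartz_nbhs psi N delta chi ->
         Normc.normc (T chi - T psi) < e).

End test_functions.

Section functions.
Context {R : realType} {n : nat}.
Implicit Types (f : 'rV[R]_n.+1 -> R[i]) (D B : set 'rV[R]_n.+1).
Local Notation leb := (@lebesgue R n).

Definition cmeasurable f : Prop :=
  measurable_fun [set: lebesgue_space R n] (@complex.Re R \o f) /\
  measurable_fun [set: lebesgue_space R n] (@complex.Im R \o f).

Definition cintegral D f : R[i] :=
  Complex (Rintegral leb D (@complex.Re R \o f))
          (Rintegral leb D (@complex.Im R \o f)).

Definition clocally_integrable f : Prop :=
  cmeasurable f /\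
  forall K : set 'rV[R]_n.+1, compact K ->
    (\int[leb]_(x in K) (Normc.normc (f x))%:E < +oo)%E.

(* The library has ln t = 0 for t <= 0, so logp 0 = 0. *)
Definition logp (t : R) : R := Num.max (ln t) 0.

Definition LloglogL B f : Prop :=
  [/\ clocally_integrable f,
      closure [set x | f x != 0] `<=` B &
      (\int[leb]_(x in B)
         (Normc.normc (f x) * logp (logp (Normc.normc (f x))))%:E < +oo)%E].

Definition distribution_of f : ('rV[R]_n.+1 -> R[i]) -> R[i] :=
  fun psi => cintegral setT (fun x => f x * psi x).

End functions.

Section Hlog.
Context {R : realType} {n : nat}.
Implicit Types (phi : 'rV[R]_n.+1 -> R) (T : ('rV[R]_n.+1 -> R[i]) -> R[i])
  (x : 'rV[R]_n.+1).
Local Notation leb := (@lebesgue R n).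

Definition admissible_kernel phi : Prop :=
  [/\ smooth phi, (forall x, 0 <= phi x),
      closure [set x | phi x != 0] `<=` unit_ball,
      (\int[leb]_x (phi x)%:E = 1)%E &
      exists c : R, forall x, enorm x <= 1 / 2 -> phi x = c].

Definition dilate phi (eps : R) x : R := eps ^- n.+1 * phi (eps^-1 *: x).

Definition convolve T phi x : R[i] := T (fun y => (phi (x - y))%:C%C).

Definition maximal phi T x : \bar R :=
  ereal_sup [set (Normc.normc (convolve T (dilate phi eps) x))%:E
            | eps in [set eps : R | 0 < eps]].

Definition Psi x (t : R) : R :=
  t / (ln (expR 1 + t) + ln (expR 1 + enorm x)).

(* Psi extended by continuity to t = +oo, a value the maximal function may
   take; the value at -oo is irrelevant since maximal phi T x >= 0. *)
Definition ePsi x (t : \bar R) : \bar R :=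
  match t with
  | t%:E => (Psi x t)%:E
  | +oo => +oo
  | -oo => 0
  end%E.

Definition Hlog phi : set (('rV[R]_n.+1 -> R[i]) -> R[i]) :=
  [set T | tempered_distribution T /\
           (\int[leb]_x ePsi x (maximal phi T x) < +oo)%E].

End Hlog.

(* Main.v *)
Require Import Defs.
From mathcomp Require Import all_boot all_order all_algebra.
From mathcomp Require Import complex.
From mathcomp Require Import all_classical all_reals all_analysis.
From mathcomp Require Import measurable_realfun.
From mathcomp Require Import ring lra.

Set Implicit Arguments.
Unset Strict Implicit.
Unset Printing Implicit Defensive.
Import Order.TTheory GRing.Theory Num.Theory.
Import numFieldNormedType.Exports.

Local Open Scope classical_set_scope.
Local Open Scope ring_scope.

(* Near the support, M_phi f <= C e^k off a set E_k whose measure is at most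
   C e^-k times the integral of |f| over {|f| > e^k}: this is the weak (1,1)
   bound for cubes, applied to the part of f above height e^k, while the part
   below contributes at most C e^k everywhere. As Psi (x, t) <= t / k for
   t >= e^k, summing over k bounds the integral of Psi (x, M_phi f) by that of
   |f| times the sum of 1 / k over e^k < |f|, i.e. by |f| (1 + log log |f|).
   Far from the support, the vanishing mean and the Lipschitz continuity of phi
   give M_phi f (x) <= C |x|^-(d+1), which is integrable over dyadic shells.
   Cubes, i.e. balls for the sup norm, replace Euclidean balls throughout, and
   only upper bounds on their measure are needed. *)

(** * Measurability and volume bounds in R^d *)

(** Cutting the interval from [u] to [v] at [a] preserves total length, an empty interval counting
    0. This is the additivity behind cutting a box by a hyperplane. *)
Lemma max0_sub_split (R : realDomainType) (u v a : R) :
  Num.max 0 (v - u) =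
  Num.max 0 (Num.min v a - u) + Num.max 0 (v - Num.max u a).
Proof.
rewrite /Order.min /Order.max.
by case: (ltP v a) => ?; case: (ltP u a) => ?; repeat (case: ltP => ?); lra.
Qed.

Section lebesgue_space_theory.
Context {R : realType} {n : nat}.
Local Notation V := 'rV[R]_n.+1.
Local Notation leb := (@lebesgue R n).
Implicit Types (c x : V) (r : R).

Lemma ball_rVP c r x : 0 < r ->
  ball c r x <-> forall i, `|c 0 i - x 0 i| < r.
Proof.
move=> r0; split=> [[_ h] i|h]; first exact: h.
by split=> // i j; rewrite (ord1 i); exact: h.
Qed.

Lemma ball_rV0 c r : r <= 0 -> ball c r = set0.
Proof. by move=> r0; apply/seteqP; split=> // x []; rewrite ltNge r0. Qed.

Lemma normr_coord_le x i : `|x 0 i| <= `|x|.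
Proof.
by rewrite [leRHS]/Num.norm /= mx_normrE; apply: le_trans (le_bigmax _ _ (0, i)).
Qed.

Lemma enorm_ge_norm x : `|x| <= enorm x.
Proof.
rewrite [leLHS]/Num.norm/= mx_normrE; apply/bigmax_leP; split=> [|[i j] _ /=].
  exact: sqrtr_ge0.
rewrite (ord1 i) -sqrtr_sqr ler_wsqrtr// (bigD1 j)//= lerDl.
by apply: sumr_ge0 => k _; exact: sqr_ge0.
Qed.

Lemma lebesgue_ball_le c r : 0 <= r ->
  (leb (ball c r) <= ((r *+ 2) ^+ n.+1)%:E)%E.
Proof.
rewrite le_eqVlt => /predU1P[<-|r0].
  by rewrite ball_rV0// mul0rn expr0n/= measure0.
(* A cover is an infinite sequence: one half-open cube, padded with degenerate boxes of volume 0. *)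
pose I (k : nat) : V * V :=
  if k == 0%N then (c - const_mx r, c + const_mx r) else (0, 0).
have vI0 : vol (I 0%N) = (r *+ 2) ^+ n.+1.
  rewrite /vol /I eqxx/= -[in RHS](card_ord n.+1) -prodr_const.
  apply: eq_bigr => i _; rewrite !mxE max_r; last by lra.
  by lra.
have vI k : k != 0%N -> vol (I k) = 0.
  by move=> k0; rewrite /vol /I (negbTE k0) (bigD1 ord0)//= subrr maxxx mul0r.
apply: (@le_trans _ _ (\sum_(0 <= k <oo) (vol (I k))%:E)%E).
  apply: ereal_inf_lbound; exists I => // x /ball_rVP-/(_ r0) xr.
  exists 0%N => //= i; rewrite /I/= !mxE.
  by have := xr i; rewrite ltr_distlC => /andP[/ltW -> ->].
rewrite (@nneseriesD1 _ _ 0%N)//= => [|k _]; last by rewrite lee_fin vol_ge0.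
by rewrite vI0 eseries0 ?adde0// => k _ /= k0; rewrite vI.
Qed.

(** Caratheodory's criterion holds because a hyperplane cuts every box of a cover of [X] into two
    boxes, [J k] and [K k], whose volumes add up; the two families cover the two parts of [X]. *)
Lemma measurable_halfspace i (a : R) :
  measurable [set x : lebesgue_space R n | x 0 i < a].
Proof.
rewrite -[measurable _]/((@lebesgue_outer R n).-caratheodory _).
apply: le_caratheodory_measurable => X; apply: le_ereal_inf_tmp => _ [I XI <-].
pose J k : V * V :=
  ((I k).1, \row_j (if j == i then Num.min ((I k).2 0 j) a else (I k).2 0 j)).
pose K k : V * V :=
  (\row_j (if j == i then Num.max ((I k).1 0 j) a else (I k).1 0 j), (I k).2).
have vIE k : vol (I k) = vol (J k) + vol (K k).
  rewrite /vol (bigD1 i)//= [in X in _ = X + _](bigD1 i)//=.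
  rewrite [in X in _ = _ + X](bigD1 i)//= !mxE eqxx.
  set P := \prod_(_ | _) _.
  rewrite [in X in _ = X * _ + _]/= (_ : \prod_(_ | _) _ = P); last first.
    by apply: eq_bigr => j /negbTE ji; rewrite !mxE ji.
  rewrite (_ : \prod_(j | j != i) Num.max 0 ((I k).2 0 j - _) = P); last first.
    by apply: eq_bigr => j /negbTE ji; rewrite !mxE ji.
  rewrite -mulrDl; congr (_ * _).
  set u := (I k).1 0 i; set v := (I k).2 0 i.
  exact: max0_sub_split.
under eq_eseriesr do rewrite vIE EFinD.
rewrite nneseriesD => [|k _ _|k _ _]; [|by rewrite lee_fin vol_ge0..].
apply: leeD; apply: ereal_inf_lbound.
  exists J => // x [/XI [k _ kx] /= xa]; exists k => // j.
  by have /andP[-> /=] := kx j; rewrite !mxE; case: eqP => // ->;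
    rewrite lt_min xa andbT.
exists K => // x [/XI [k _ kx] /= /negP]; rewrite -leNgt => xa; exists k => // j.
by have /andP[+ ->] := kx j; rewrite !mxE andbT; case: eqP => // ->;
  rewrite ge_max xa andbT.
Qed.

Lemma measurable_coord i :
  measurable_fun [set: lebesgue_space R n] (fun x : lebesgue_space R n => (x : V) 0 i).
Proof.
move=> mD; apply: (measurability _ (RGenInftyO.measurableE R)) => //.
move=> _ [_ [a ->] <-]; rewrite setTI.
rewrite (_ : _ @^-1` _ = [set x : lebesgue_space R n | (x : V) 0 i < a]).
  exact: measurable_halfspace.
by apply/seteqP; split=> x /=; rewrite in_itv.
Qed.

Lemma measurable_ball_rV c r : measurable (ball c r : set (lebesgue_space R n)).
Proof.
have [r0|r0] := leP r 0; first by rewrite ball_rV0//; exact: measurable0.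
rewrite (_ : ball c r = \bigcap_(i in [set: 'I_n.+1])
    ((fun x : lebesgue_space R n => (x : V) 0 i) @^-1` ball (c 0 i) r)).
  apply: fin_bigcap_measurable => // i _; rewrite -[X in measurable X]setTI.
  by apply: measurable_coord => //; exact: measurable_ball.
apply/seteqP; split=> x.
  by move=> /(ball_rVP _ _ r0) h i _; exact: h.
by move=> h; apply/ball_rVP => // i; exact: (h i I).
Qed.

Lemma rat_approx x r : 0 < r -> exists q : 'rV[rat]_n.+1, ball x r (map_mx ratr q).
Proof.
move=> r0.
have h i : {q : rat | `|x 0 i - ratr q| < r}.
  apply: cid; have /rat_in_itvoo[q] : x 0 i - r < x 0 i + r by lra.
  by rewrite in_itv/= => qx; exists q; rewrite ltr_distlC.
exists (\row_i projT1 (h i)); apply/ball_rVP => // i.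
by rewrite !mxE; exact: (projT2 (h i)).
Qed.

(** A countable family, so the union of any subfamily is measurable; open sets and the exceptional
    set of the weak-type bound are such unions. *)
Definition rat_ball (p : 'rV[rat]_n.+1 * rat) : set V :=
  ball (map_mx ratr p.1 : V) (ratr p.2).

Lemma measurable_bigcup_rat_ball (P : set ('rV[rat]_n.+1 * rat)) :
  measurable (\bigcup_(p in P) rat_ball p : set (lebesgue_space R n)).
Proof.
rewrite bigcup_mkcond; apply: countable_bigcupT_measurable => [|p].
  exact: countableP.
by case: ifP => _; [exact: measurable_ball_rV|exact: measurable0].
Qed.

Lemma open_measurable_rV (U : set V) : open U ->
  measurable (U : set (lebesgue_space R n)).
Proof.
move=> oU.
rewrite (_ : U = \bigcup_(p in [set p | rat_ball p `<=` U]) rat_ball p).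
  exact: measurable_bigcup_rat_ball.
apply/seteqP; split=> [x Ux|x [p /= pU /pU]//].
have /nbhs_ballP[e /= e0 eU] := open_nbhs_nbhs (conj oU Ux).
(* A rational centre within [r] of [x], with [r] below [e / 2], keeps the ball of radius [r] inside
   the ball of radius [e] at [x]. *)
have e2 : 0 < e / 2 by lra.
have /rat_in_itvoo[r] := e2.
rewrite in_itv/= => /andP[r0 re].
have [q xq] := rat_approx x r0.
exists (q, r) => [y qy|]; last exact: ball_sym.
apply: eU; apply: (@le_ball _ _ _ (ratr r + ratr r)); first by lra.
exact: ball_triangle xq qy.
Qed.

Lemma continuous_measurable_rV (g : V -> R) : continuous g ->
  measurable_fun [set: lebesgue_space R n] (g : lebesgue_space R n -> R).
Proof.
move=> cg mD; apply: (measurability _ (RGenInftyO.measurableE R)) => //.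
move=> _ [_ [a ->] <-]; rewrite setTI; apply: open_measurable_rV.
by have /continuousP := cg; apply; exact: interval_open.
Qed.

End lebesgue_space_theory.

(* Measurability is not needed, as the integral is a supremum over simple
   functions: the maximal function need not be shown measurable. *)
Lemma le_nnintegral d (T : measurableType d) (R : realType)
    (mu : {measure set T -> \bar R}) (f g : T -> \bar R) :
  (forall x, 0 <= f x)%E -> (forall x, f x <= g x)%E ->
  (\int[mu]_x f x <= \int[mu]_x g x)%E.
Proof.
move=> f0 fg; rewrite !ge0_integralTE// => [|x]; last exact: le_trans (fg x).
by apply: ereal_sup_le => _ [h hf <-]; exists h => // x; exact: le_trans (fg x).
Qed.

Lemma integralD_lty d (T : measurableType d) (R : realType)
    (mu : {measure set T -> \bar R}) (f g : T -> \bar R) :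
  (forall x, 0 <= f x)%E -> (forall x, 0 <= g x)%E ->
  measurable_fun setT f -> measurable_fun setT g ->
  (\int[mu]_x f x < +oo)%E -> (\int[mu]_x g x < +oo)%E ->
  (\int[mu]_x (f x + g x) < +oo)%E.
Proof. by move=> f0 g0 mf mg fo go; rewrite ge0_integralD// lte_add_pinfty. Qed.

(** * Weak-type estimate *)

Lemma seq_argmax (R : realDomainType) (T : eqType) (f : T -> R) (l : seq T) :
  l != [::] -> exists2 p, p \in l & {in l, forall q, f q <= f p}.
Proof.
elim: l => // a l IH _; have [->|/IH[p pl pM]] := eqVneq l [::].
  by exists a => [|q]; rewrite ?mem_head// inE => /eqP ->.
have [ap|/ltW pa] := leP (f a) (f p).
  by exists p => [|q]; rewrite inE ?pl ?orbT// => /predU1P[->//|/pM].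
exists a => [|q]; first exact: mem_head.
by rewrite inE => /predU1P[->//|/pM/le_trans]; exact.
Qed.

Section weak_type.
Context {R : realType} {n : nat}.
Local Notation V := 'rV[R]_n.+1.
Local Notation leb := (@lebesgue R n).
Variables h : lebesgue_space R n -> \bar R.
Hypotheses (h0 : forall x, (0 <= h x)%E) (mh : measurable_fun setT h).

Let pball (p : V * R) : set (lebesgue_space R n) := ball p.1 p.2.

Let integral_h_le (A B : set (lebesgue_space R n)) :
  measurable A -> measurable B -> A `<=` B ->
  (\int[leb]_(x in A) h x <= \int[leb]_(x in B) h x)%E.
Proof.
by move=> mA mB AB; apply: ge0_subset_integral => //; exact: measurable_funTS.
Qed.

(* Vitali selection: a ball of largest radius, dilated by 3, swallows every
   ball meeting it; recurse on the balls disjoint from it. *)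
Lemma finite_weak_type (s : R) (l : seq (V * R)) : 0 < s ->
  {in l, forall p, 0 < p.2 /\
    ((s * p.2 ^+ n.+1)%:E <= \int[leb]_(x in pball p) h x)%E} ->
  (s%:E * leb (\bigcup_(p in [set` l]) pball p) <=
   (6 ^+ n.+1)%:E * \int[leb]_(x in \bigcup_(p in [set` l]) pball p) h x)%E.
Proof.
move=> s0; have mU (k : seq (V * R)) : measurable (\bigcup_(p in [set` k]) pball p).
  apply: fin_bigcup_measurable; first exact: finite_seq.
  by move=> p _; exact: measurable_ball_rV.
have [k] := ubnP (size l); elim: k l => // k IH l lk hl.
have [->|l0] := eqVneq l [::].
  rewrite (_ : \bigcup_(_ in _) _ = set0); last first.
    by apply/seteqP; split=> // x [].
  by rewrite measure0 integral_set0 !mule0.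
have [p pl pM] := seq_argmax snd l0.
have [p0 hp] := hl _ pl.
pose l' := [seq q <- l | `[< pball q `&` pball p = set0 >]].
have l'l : {subset l' <= l} by move=> q; rewrite mem_filter => /andP[].
(* The list shrinks because [p] itself is dropped: its ball is nonempty, hence meets itself. *)
have l'k : (size l' < k)%N.
  apply: (@leq_trans (size l)); last by rewrite -ltnS.
  rewrite size_filter -[ltnLHS]addn0.
  rewrite -(count_predC (fun q => `[< pball q `&` pball p = set0 >]) l) ltn_add2l.
  rewrite -has_count; apply/hasP; exists p => //=.
  by apply/asboolPn; rewrite setIid; apply/eqP/set0P; exists p.1; exact: ballxx.
set U' := \bigcup_(q in [set` l']) pball q.
set U := \bigcup_(q in [set` l]) pball q.
have hU' : (s%:E * leb U' <= (6 ^+ n.+1)%:E * \int[leb]_(x in U') h x)%E.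
  by apply: (IH l' l'k) => q /l'l /hl.
pose B3 : set (lebesgue_space R n) := ball p.1 (p.2 *+ 3).
have mB3 : measurable B3 by exact: measurable_ball_rV.
have mB : measurable (pball p) by exact: measurable_ball_rV.
have mU' : measurable U' by exact: mU.
have mUl : measurable U by exact: mU.
have UB : U `<=` B3 `|` U'.
  move=> x [q /= ql qx].
  have [qp|/eqP/set0P[y [qy py]]] := pselect (pball q `&` pball p = set0).
    by right; exists q => //=; rewrite mem_filter ql andbT; exact/asboolP.
  left; rewrite /B3 mulrS mulr2n.
  apply: (@le_ball _ _ _ (p.2 + (q.2 + q.2))); first by rewrite lerD2l lerD// pM.
  apply: ball_triangle py _; apply: ball_triangle qx; exact: ball_sym.
have UU : pball p `|` U' `<=` U.
  by move=> x [px|[q /l'l ql qx]]; [exists p|exists q].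
have lU : (s%:E * leb U <= s%:E * (leb B3 + leb U'))%E.
  apply: lee_wpmul2l; first by rewrite lee_fin ltW.
  apply: le_trans (measureU2 _ mB3 (mU l')).
  by apply: le_measure => //; rewrite inE; [exact: mU|exact: measurableU].
apply: (le_trans lU); rewrite ge0_muleDr//.
apply: (@le_trans _ _ ((6 ^+ n.+1)%:E * \int[leb]_(x in pball p `|` U') h x)%E);
  last first.
  apply: lee_wpmul2l; [by rewrite lee_fin exprn_ge0|apply: integral_h_le => //].
  exact: measurableU.
rewrite ge0_integral_setU//; last 2 first.
  exact: measurable_funTS.
  apply/disj_setPS => x [px [q /= + qx]]; rewrite mem_filter => /andP[/asboolP + _].
  by move=> qp0; have : set0 x by rewrite -qp0.
rewrite ge0_muleDr ?integral_ge0//; apply: leeD => //.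
apply: (@le_trans _ _ ((6 ^+ n.+1)%:E * (s * p.2 ^+ n.+1)%:E)%E); last first.
  by apply: lee_wpmul2l => //; rewrite lee_fin exprn_ge0.
have r0 : 0 <= p.2 *+ 3 by rewrite mulrn_wge0// ltW.
(* The tripled cube has side [6 r], whence the constant [6 ^ d]. *)
apply: (@le_trans _ _ (s%:E * ((p.2 *+ 3 *+ 2) ^+ n.+1)%:E)%E).
  by apply: lee_wpmul2l; [rewrite lee_fin ltW|exact: lebesgue_ball_le].
by rewrite -!EFinM lee_fin -mulrnA -[p.2 *+ _]mulr_natl exprMn mulrCA.
Qed.

(** The finite case applies to the members of [P] with code below [k]; these unions increase to the
    full one, and continuity of the measure from below passes to the limit. *)
Lemma countable_weak_type (s : R) (P : set ('rV[rat]_n.+1 * rat)) : 0 < s ->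
  (forall p, P p -> 0 < (ratr p.2 : R) /\
    ((s * ratr p.2 ^+ n.+1)%:E <= \int[leb]_(x in rat_ball p) h x)%E) ->
  (s%:E * leb (\bigcup_(p in P) rat_ball p) <=
   (6 ^+ n.+1)%:E * \int[leb]_x h x)%E.
Proof.
move=> s0 hP.
pose real_pair (p : 'rV[rat]_n.+1 * rat) : V * R := (map_mx ratr p.1, ratr p.2).
pose l k := [seq p <- pmap unpickle (iota 0 k) | `[< P p >]].
pose F k := \bigcup_(p in [set` l k]) (rat_ball p : set (lebesgue_space R n)).
have lP k p : p \in l k -> P p by rewrite mem_filter => /andP[/asboolP].
have FE k : F k = \bigcup_(p in [set` map real_pair (l k)]) pball p.
  apply/seteqP; split=> x [p /= pl px].
    by exists (real_pair p) => //=; exact: map_f.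
  by have /mapP[q ql pq] := pl; exists q => //=; rewrite pq in px.
have mF k : measurable (F k) by exact: measurable_bigcup_rat_ball.
have EF : \bigcup_(p in P) rat_ball p = \bigcup_k F k.
  apply/seteqP; split=> [x [p Pp px]|x [k _ [p /lP Pp px]]]; last by exists p.
  exists (pickle p).+1 => //; exists p => //=; rewrite mem_filter.
  apply/andP; split; first exact/asboolP.
  rewrite mem_pmap; apply/mapP; exists (pickle p); last by rewrite pickleK.
  by rewrite mem_iota/= add0n ltnS.
have ndF : {homo F : m k / (m <= k)%N >-> (m <= k)%O}.
  move=> m k mk; apply/subsetPset => x [p /= pm px]; exists p => //=.
  move: pm; rewrite !mem_filter => /andP[-> /=]; rewrite !mem_pmap.
  move=> /mapP[j jm ->]; apply: map_f; move: jm; rewrite !mem_iota/= !add0n.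
  by move=> /leq_trans; exact.
have mE : measurable (\bigcup_k F k) by exact: bigcup_measurable.
have cvF := nondecreasing_cvg_mu (mu := leb) mF mE ndF.
rewrite EF.
have sF k : (s%:E * leb (F k) <= (6 ^+ n.+1)%:E * \int[leb]_x h x)%E.
  rewrite FE; apply: le_trans (finite_weak_type s0 _) _.
    by move=> _ /mapP[p /lP/hP[? ?] ->].
  apply: lee_wpmul2l; [by rewrite lee_fin exprn_ge0|apply: integral_h_le => //].
  by rewrite -FE.
have cvsF := cvgeZl (isT : s%:E \is a fin_num) cvF; rewrite -(cvg_lim _ cvsF)//.
apply: lime_le; first by apply/cvg_ex; eexists; exact: cvsF.
by apply: nearW => k; exact: sF.
Qed.

Lemma weak_type (s : R) : 0 < s -> exists E : set (lebesgue_space R n),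
  [/\ measurable E,
      (s%:E * leb E <= (18 ^+ n.+1)%:E * \int[leb]_x h x)%E &
      forall x r, ~ E x -> 0 < r ->
        (\int[leb]_(y in ball (x : V) r) h y <= (s * r ^+ n.+1)%:E)%E].
Proof.
move=> s0.
(* A ball of radius r sits in a rational one of radius below 3 r. *)
pose s' := s / 3 ^+ n.+1.
have s'E : s' * 3 ^+ n.+1 = s by rewrite divfK// expf_neq0.
pose P : set ('rV[rat]_n.+1 * rat) := [set p | 0 < (ratr p.2 : R) /\
  ((s' * ratr p.2 ^+ n.+1)%:E <= \int[leb]_(x in rat_ball p) h x)%E].
exists (\bigcup_(p in P) rat_ball p); split.
- exact: measurable_bigcup_rat_ball.
- rewrite -s'E mulrC EFinM -muleA.
  apply: (@le_trans _ _ ((3 ^+ n.+1)%:E *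
      ((6 ^+ n.+1)%:E * \int[leb]_x h x))%E); last first.
    by rewrite muleA -EFinM -exprMn -natrM.
  apply: lee_wpmul2l; first by rewrite lee_fin exprn_ge0.
  by apply: countable_weak_type; rewrite ?divr_gt0 ?exprn_gt0// => p [].
- move=> x r Ex r0; rewrite leNgt; apply/negP => hr; apply: Ex.
  (* A radius above [2 r] around a centre within [r] of [x] contains the whole ball at [x]; a radius
     below [3 r] costs the factor [3 ^ d] built into [s']. *)
  have /rat_in_itvoo[t] : r *+ 2 < r *+ 3 by rewrite ltr_pMn2l.
  rewrite in_itv/= => /andP[rt tr].
  have [q xq] := rat_approx (x : V) r0.
  have rt' : r <= ratr t by rewrite (le_trans _ (ltW rt))// mulr2n lerDl ltW.
  exists (q, t); last exact: le_ball rt' _ (ball_sym xq).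
  split=> /=; first exact: lt_le_trans rt'.
  apply: (@le_trans _ _ (s * r ^+ n.+1)%:E).
    rewrite lee_fin -[in leRHS]s'E -mulrA -exprMn ler_pM2l ?divr_gt0 ?exprn_gt0//.
    rewrite mulr_natl lerXn2r ?nnegrE ?mulrn_wge0 ?(ltW r0) ?(ltW tr)//.
    exact: le_trans (ltW r0) rt'.
  apply: (le_trans (ltW hr)); apply: integral_h_le.
  + exact: measurable_ball_rV.
  + exact: measurable_ball_rV.
  + move=> y xy; apply: (@le_ball _ _ _ (r + r)); first by rewrite -mulr2n ltW.
    exact: ball_triangle (ball_sym xq) xy.
Qed.

End weak_type.

(** * Bounds on the kernel *)

Lemma compact_unit_cube (R : realType) (n : nat) :
  compact [set x : 'rV[R]_n.+1 | `|x| <= 1].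
Proof.
apply: bounded_closed_compact.
  by exists 1; split => // M M1 x /= x1; exact: le_trans x1 (ltW M1).
have : continuous (fun x : 'rV[R]_n.+1 => `|x|) by move=> x; exact: norm_continuous.
by move=> /continuous_closedP /(_ _ (@closed_le R 1)).
Qed.

Section smooth_kernels.
Context {R : realType} {n : nat}.
Local Notation V := 'rV[R]_n.+1.
Implicit Types (g : V -> R) (x y : V).

Lemma bounded_of_support g : continuous g ->
  (forall x, 1 < `|x| -> g x = 0) -> exists2 A, 0 < A & forall x, `|g x| <= A.
Proof.
move=> cg g0.
have cB := @compact_unit_cube R n.
have cng : {within [set x : V | `|x| <= 1], continuous (fun x => `|g x|)}.
  apply: continuous_subspaceT => x; apply: continuous_comp; first exact: cg.
  exact: norm_continuous.
have [|c cB1 cM] := compact_EVT_max _ cB cng.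
  by exists 0 => /=; rewrite normr0.
(* Adding 1 keeps the bound positive even if [g] vanishes identically. *)
exists (`|g c| + 1) => [|x]; first by rewrite ltr_wpDl.
have [x1|x1] := leP `|x| 1.
  by rewrite (le_trans (cM x _)) ?lerDl// inE.
by rewrite g0// normr0 addr_ge0.
Qed.

(** The mean value theorem along a coordinate line; a negative [t] is reduced to a positive one by
    exchanging the endpoints. *)
Lemma derive_coord_bound g i A :
  (forall x, derivable g x (delta_mx 0 i)) ->
  (forall x, `|'D_(delta_mx 0 i) g x| <= A) ->
  forall x (t : R), `|g (x + t *: delta_mx 0 i) - g x| <= A * `|t|.
Proof.
move=> dg gA x t; pose e : V := delta_mx 0 i.
wlog t0 : x t / 0 <= t.
  move=> H; have [/H//|/ltW t0] := leP 0 t.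
  by have := H (x + t *: e) (- t); rewrite oppr_ge0 scaleNr addrK normrN distrC; exact.
pose G (u : R) := g (x + u *: e).
have dG (u : R) : is_derive u (1 : R) G ('D_e g (x + u *: e)).
  have GE : (fun h : R => h^-1 *: ((G \o shift u) (h *: 1) - G u)) =
      (fun h : R => h^-1 *: ((g \o shift (x + u *: e)) (h *: e) - g (x + u *: e))).
    apply/funext => h /=; rewrite /G /shift/=; congr (_ *: (g _ - _)).
    by rewrite -[h%:A]/(h * 1) mulr1 scalerDl addrCA.
  split.
    by rewrite /derivable GE; exact: dg.
  by rewrite /derive GE.
have cG : {within `[0, t], continuous G}.
  by apply: derivable_within_continuous => u _; have [] := dG u.
have [c _] := MVT_segment t0 (fun u _ => dG u) cG.
rewrite /G scale0r addr0 subr0 => ->.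
by rewrite normrM ler_wpM2r.
Qed.

(** Walk from [y] to [x] one coordinate at a time: each of the [n.+1] moves costs at most [A] times
    the sup norm of [x - y]. The induction is on an arbitrary list of coordinates. *)
Lemma lipschitz_of_coord g A : 0 <= A ->
  (forall i x (t : R), `|g (x + t *: delta_mx 0 i) - g x| <= A * `|t|) ->
  forall x y, `|g x - g y| <= A *+ n.+1 * `|x - y|.
Proof.
move=> A0 gA x y.
have H (s : seq 'I_n.+1) (v : V) :
    `|g (y + \sum_(i <- s) v 0 i *: delta_mx 0 i) - g y| <= A * `|v| *+ size s.
  elim: s => [|i s IH]; first by rewrite big_nil addr0 subrr normr0.
  rewrite big_cons [_ + \sum_(_ <- _) _]addrC addrA.
  rewrite -(subrKA (g (y + \sum_(j <- s) v 0 j *: delta_mx 0 j))).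
  rewrite (le_trans (ler_normD _ _))//= mulrS lerD// (le_trans (gA _ _ _))//.
  by rewrite ler_wpM2l// normr_coord_le.
rewrite mulrnAl -[X in g X - _](subrKC y) [X in g (y + X)]row_sum_delta.
by have := H (enum 'I_n.+1) (x - y); rewrite size_enum_ord big_enum.
Qed.

(** Collects what the estimates use of [phi]. The Euclidean unit ball lies in the sup-norm one, and
    the first partial derivatives are continuous with support there, hence bounded, which gives the
    Lipschitz constant. *)
Lemma admissible_kernel_bounds (phi : V -> R) : admissible_kernel phi ->
  exists2 A, 0 < A & exists2 L, 0 < L &
  [/\ continuous phi, forall x, 1 < `|x| -> phi x = 0, forall x, `|phi x| <= A &
      forall x y, `|phi x - phi y| <= L * `|x - y|].
Proof.
move=> [sphi _ supp _ _].
have phi0 x : 1 < `|x| -> phi x = 0.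
  move=> x1; apply/eqP; apply: contraTT x1 => phix; rewrite -leNgt.
  by apply: le_trans (enorm_ge_norm x) _; apply: supp; exact: subset_closure.
have [cphi _] := sphi [::].
have [A A0 hA] := bounded_of_support cphi phi0.
(* Vanishing on a neighbourhood, and not just at the point, makes the derivatives vanish too. *)
have near0 x : 1 < `|x| -> \forall y \near x, phi y = 0.
  move=> x1; have : \forall y \near x, 1 < `|y|.
    by apply: (cvgr_gt _ (@norm_continuous _ _ x)); exact: x1.
  by apply: filterS => y /phi0.
have [M M0 hM] : exists2 M, 0 < M &
    forall i x, `|'D_(delta_mx 0 i) phi x| <= M.
  have H i : exists2 M, 0 < M & forall x, `|'D_(delta_mx 0 i) phi x| <= M.
    have [cd _] := sphi [:: i]; apply: (bounded_of_support cd) => x x1 /=.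
    by rewrite (near_eq_derive (g := cst 0)) ?derive_cst//; exact: near0.
  pose m i := projT1 (cid2 (H i)).
  exists (\sum_i m i) => [|i x].
    rewrite (bigD1 ord0)//= ltr_pwDl// ?sumr_ge0//.
      by rewrite /m; case: cid2.
    by move=> i _; rewrite /m; case: cid2 => ? /= /ltW.
  apply: (@le_trans _ _ (m i)); first by rewrite /m; case: cid2.
  rewrite (bigD1 i)//= lerDl sumr_ge0// => j _.
  by rewrite /m; case: cid2 => ? /= /ltW.
exists A => //; exists (M *+ n.+1); first by rewrite pmulrn_lgt0.
split=> //; apply: lipschitz_of_coord (ltW M0) _ => i; apply: derive_coord_bound => //.
by have [_] := sphi [::]; exact.
Qed.

End smooth_kernels.

(** * Integrals of complex functions *)

Section complex_integral.
Context {R : realType} {n : nat}.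
Local Notation V := 'rV[R]_n.+1.
Local Notation leb := (@lebesgue R n).
Local Notation normc := Normc.normc.
Implicit Types (f g : V -> R[i]).

Lemma normc_ge_Re (z : R[i]) : `|complex.Re z| <= normc z.
Proof.
by case: z => a b; rewrite /= -sqrtr_sqr ler_wsqrtr// lerDl sqr_ge0.
Qed.

Lemma normc_ge_Im (z : R[i]) : `|complex.Im z| <= normc z.
Proof.
by case: z => a b; rewrite /= -sqrtr_sqr ler_wsqrtr// lerDr sqr_ge0.
Qed.

Lemma normc_le_ReIm (z : R[i]) : normc z <= `|complex.Re z| + `|complex.Im z|.
Proof.
case: z => a b /=; rewrite -(ger0_norm (addr_ge0 (normr_ge0 a) (normr_ge0 b))).
rewrite -sqrtr_sqr ler_wsqrtr// -(real_normK (num_real a)).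
by rewrite -(real_normK (num_real b)) sqrrD lerD2r lerDl mulrn_wge0// mulr_ge0.
Qed.

Lemma normc_ge0 (z : R[i]) : 0 <= normc z.
Proof. by case: z => a b; exact: sqrtr_ge0. Qed.

Lemma normc_real (a : R) : normc a%:C%C = `|a|.
Proof. by rewrite /= expr0n/= addr0 sqrtr_sqr. Qed.

Lemma measurable_normc f : cmeasurable f ->
  measurable_fun [set: lebesgue_space R n] (fun x : lebesgue_space R n => normc (f x)).
Proof.
move=> [mr mi].
pose q (x : lebesgue_space R n) := complex.Re (f x) ^+ 2 + complex.Im (f x) ^+ 2.
rewrite (_ : (fun _ => _) = @Num.sqrt R \o q); last first.
  by apply/funext => x; rewrite /q/=; case: (f x).
apply: measurableT_comp.
  by apply: continuous_measurable_fun; exact: sqrt_continuous.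
by apply: measurable_funD; exact: measurable_funX.
Qed.

Lemma cmeasurableM f g : cmeasurable f -> cmeasurable g ->
  cmeasurable (fun x => f x * g x).
Proof.
move=> [fr fi] [gr gi]; split.
  rewrite (_ : _ \o _ = (fun x => complex.Re (f x) * complex.Re (g x)) \-
      (fun x => complex.Im (f x) * complex.Im (g x))).
    by apply: measurable_funB; apply: measurable_funM.
  by apply/funext => x /=; case: (f x) => a b; case: (g x).
rewrite (_ : _ \o _ = (fun x => complex.Re (f x) * complex.Im (g x)) \+
    (fun x => complex.Im (f x) * complex.Re (g x))).
  by apply: measurable_funD; apply: measurable_funM.
by apply/funext => x /=; case: (f x) => a b; case: (g x).
Qed.

Lemma cmeasurable_continuous g : continuous (@complex.Re R \o g) ->
  continuous (@complex.Im R \o g) -> cmeasurable g.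
Proof. by move=> cr ci; split; exact: continuous_measurable_rV. Qed.

Definition cintegrable f := cmeasurable f /\
  (\int[leb]_x (normc (f x))%:E < +oo)%E.

Lemma integrable_of_normc_bound f (u : lebesgue_space R n -> R) :
  (\int[leb]_x (normc (f x))%:E < +oo)%E ->
  measurable_fun setT u -> (forall x, `|u x| <= normc (f x)) ->
  leb.-integrable setT (EFin \o u).
Proof.
move=> foo mu uf; apply/integrableP; split; first exact/measurable_EFinP.
apply: le_lt_trans foo; apply: le_nnintegral => x //.
by rewrite /= lee_fin.
Qed.

Lemma cintegrable_Re f : cintegrable f ->
  leb.-integrable setT (EFin \o (@complex.Re R \o f)).
Proof.
move=> [[mr _] foo]; apply: integrable_of_normc_bound foo mr _ => x.
exact: normc_ge_Re.
Qed.

Lemma cintegrable_Im f : cintegrable f ->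
  leb.-integrable setT (EFin \o (@complex.Im R \o f)).
Proof.
move=> [[_ mi] foo]; apply: integrable_of_normc_bound foo mi _ => x.
exact: normc_ge_Im.
Qed.

Lemma integral_normcM_le f g (C : R) : cmeasurable f -> 0 <= C ->
  (forall x, normc (f x * g x) <= C * normc (f x)) ->
  (\int[leb]_x (normc (f x * g x))%:E <= C%:E * \int[leb]_x (normc (f x))%:E)%E.
Proof.
move=> mf C0 fgC.
rewrite -ge0_integralZl; [|exact: measurableT|
  by apply/measurable_EFinP; exact: measurable_normc|
  by move=> x _; rewrite lee_fin normc_ge0|by rewrite lee_fin].
by apply: le_nnintegral => x; rewrite lee_fin ?normc_ge0.
Qed.

Lemma cintegrableM f g (C : R) : cintegrable f -> cmeasurable g ->
  (forall x, normc (g x) <= C) -> cintegrable (fun x => f x * g x).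
Proof.
move=> [mf foo] mg gC; split; first exact: cmeasurableM.
have C0 : 0 <= C by rewrite (le_trans _ (gC 0))// normc_ge0.
apply: le_lt_trans (integral_normcM_le (g := g) mf C0 _) _.
  by move=> x; rewrite Normc.normcM mulrC ler_wpM2r// normc_ge0.
by apply: lte_mul_pinfty => //; rewrite ?lee_fin.
Qed.

Lemma cintegral_linear (a : R[i]) f g : cintegrable f -> cintegrable g ->
  cintegral setT (fun x => a * f x + g x) =
  a * cintegral setT f + cintegral setT g.
Proof.
move=> If Ig; case: a => a b.
have [fr fi] := (cintegrable_Re If, cintegrable_Im If).
have [gr gi] := (cintegrable_Re Ig, cintegrable_Im Ig).
have Z (c : R) (u : lebesgue_space R n -> R) :
    leb.-integrable setT (EFin \o u) ->
    leb.-integrable setT (EFin \o (fun x => c * u x)).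
  move=> iu; rewrite (_ : _ \o _ = (fun x => c%:E * (EFin \o u) x))%E//.
  exact: integrableZl.
(* The real and the imaginary part of [a * f + g] both have this shape, with [c2] equal to [- b] and
   to [b] respectively. *)
have L (c1 c2 : R) (u v w : lebesgue_space R n -> R) :
    leb.-integrable setT (EFin \o u) -> leb.-integrable setT (EFin \o v) ->
    leb.-integrable setT (EFin \o w) ->
    Rintegral leb setT (fun x => c1 * u x + c2 * v x + w x) =
    c1 * Rintegral leb setT u + c2 * Rintegral leb setT v + Rintegral leb setT w.
  move=> iu iv iw; have [iu1 iv1] := (Z c1 _ iu, Z c2 _ iv).
  rewrite RintegralD//; last exact: (integrableD measurableT iu1 iv1).
  by rewrite RintegralD// !RintegralZl.
rewrite /cintegral /=; congr Complex.
  rewrite -mulNr -L//; apply: eq_Rintegral => x _ /=.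
  by case: (f x) => ? ?; case: (g x) => ? ? /=; rewrite mulNr.
rewrite -L//; apply: eq_Rintegral => x _ /=.
by case: (f x) => ? ?; case: (g x).
Qed.

(** The factor 2 comes from estimating the real and the imaginary part separately. *)
Lemma normc_cintegral_le f : cmeasurable f ->
  ((normc (cintegral setT f))%:E <= 2%:E * \int[leb]_x (normc (f x))%:E)%E.
Proof.
move=> [mr mi].
have H (u : lebesgue_space R n -> R) : measurable_fun setT u ->
    (forall x, `|u x| <= normc (f x)) ->
    (`|Rintegral leb setT u|%:E <= \int[leb]_x (normc (f x))%:E)%E.
  move=> mu uf; apply: (@le_trans _ _ `|\int[leb]_x (u x)%:E|%E).
    (* An infinite integral has [fine] value 0, while its absolute value on the right is [+oo]. *)
    by rewrite /Rintegral; case: (\int[leb]_x (u x)%:E)%E => [r||]/=; rewrite ?leey.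
  apply: le_trans (le_abse_integral leb measurableT _) _; first exact/measurable_EFinP.
  by apply: le_nnintegral => x //=; rewrite lee_fin.
apply: (@le_trans _ _ (`|Rintegral leb setT (@complex.Re R \o f)| +
    `|Rintegral leb setT (@complex.Im R \o f)|)%:E).
  by rewrite lee_fin; exact: normc_le_ReIm.
rewrite EFinD mule_natl mule2n.
apply: leeD; apply: H => // x; [exact: normc_ge_Re|exact: normc_ge_Im].
Qed.

End complex_integral.

(** * The distribution of f and its convolutions *)

Section distribution_of_integrable.
Context {R : realType} {n : nat}.
Local Notation V := 'rV[R]_n.+1.
Local Notation leb := (@lebesgue R n).
Local Notation normc := Normc.normc.
Variable f : V -> R[i].
Hypothesis If : cintegrable f.

(** The seminorm without weight and without derivatives is the sup norm. *)
Lemma normc_le_schwartz_seminorm (psi : V -> R[i]) x :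
  ((normc (psi x))%:E <= schwartz_seminorm (fun=> 0%N) [::] psi)%E.
Proof.
apply: ereal_sup_ubound; exists x => //.
rewrite /monomial big1 ?normr1 ?mul1r => [|i _]; last by rewrite expr0.
by rewrite /cpartial /=; case: (psi x).
Qed.

Lemma cintegrableM_schwartz psi : schwartz psi ->
  cintegrable (fun x => f x * psi x).
Proof.
move=> [sr si psioo]; have /= psi0 := psioo (fun=> 0%N) [::].
apply: (cintegrableM (C := fine (schwartz_seminorm (fun=> 0%N) [::] psi)) If).
  by apply: cmeasurable_continuous; [have [] := sr [::]|have [] := si [::]].
move=> x; rewrite -lee_fin fineK ?normc_le_schwartz_seminorm//.
rewrite ge0_fin_numE//; apply: le_trans (normc_le_schwartz_seminorm psi 0).
by rewrite lee_fin normc_ge0.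
Qed.

(** Pairing with an integrable [f] is continuous already for the sup norm of the test function, so
    seminorms of order [N = 0] suffice. *)
Lemma tempered_distribution_of : tempered_distribution (distribution_of f).
Proof.
have lin (a : R[i]) psi chi : schwartz psi -> schwartz chi ->
    distribution_of f (fun x => a * psi x + chi x) =
    a * distribution_of f psi + distribution_of f chi.
  move=> spsi schi; rewrite /distribution_of.
  rewrite -cintegral_linear; [|exact: cintegrableM_schwartz..].
  by congr cintegral; apply/funext => x; rewrite mulrDr mulrCA.
split=> // psi spsi e e0; exists 0%N.
have [mf foo] := If.
set I := (\int[leb]_x (normc (f x))%:E)%E in foo.
have I0 : (0 <= I)%E by apply: integral_ge0 => x _; rewrite lee_fin normc_ge0.
have IE : I = (fine I)%:E by rewrite fineK// ge0_fin_numE.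
have fI0 : 0 <= fine I by exact: fine_ge0.
(* The 2 is the factor of [normc_cintegral_le]; the 1 avoids division by 0 when [I = 0] and makes
   the final inequality strict. *)
have D0 : 0 < 2 * fine I + 1 by rewrite ltr_wpDl// mulr_ge0.
pose delta := e / (2 * fine I + 1).
have delta0 : 0 < delta by exact: divr_gt0.
exists delta => // chi [schi /(_ (fun=> 0%N) [::])].
rewrite big1// => /(_ isT isT) chipsi.
have -> : distribution_of f chi - distribution_of f psi =
    distribution_of f (fun x => -1 * psi x + chi x).
  by rewrite lin// mulN1r addrC.
have bnd x : normc (-1 * psi x + chi x) <= delta.
  rewrite mulN1r addrC -lee_fin; apply: le_trans (ltW chipsi).
  exact: (normc_le_schwartz_seminorm (fun x => chi x - psi x)).
have msc (g : V -> R[i]) : schwartz g -> cmeasurable g.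
  move=> [sr si _]; apply: cmeasurable_continuous; first by have [] := sr [::].
  by have [] := si [::].
have mg : cmeasurable (fun x => -1 * psi x + chi x).
  have [[pr pi] [cr ci]] := (msc _ spsi, msc _ schi).
  split.
    rewrite (_ : _ \o _ = (@complex.Re R \o chi) \- (@complex.Re R \o psi)).
      exact: measurable_funB.
    by apply/funext => x /=; rewrite mulN1r addrC; case: (psi x) (chi x) => ? ? [].
  rewrite (_ : _ \o _ = (@complex.Im R \o chi) \- (@complex.Im R \o psi)).
    exact: measurable_funB.
  by apply/funext => x /=; rewrite mulN1r addrC; case: (psi x) (chi x) => ? ? [].
rewrite -lte_fin; apply: le_lt_trans (normc_cintegral_le (cmeasurableM mf mg)) _.
apply: (@le_lt_trans _ _ (2%:E * (delta%:E * I))%E).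
  apply: lee_wpmul2l => //; apply: integral_normcM_le (ltW delta0) _ => // x.
  by rewrite Normc.normcM mulrC ler_wpM2r// normc_ge0.
rewrite IE -!EFinM lte_fin /delta mulrCA mulrAC ltr_pdivrMr// mulrC.
by rewrite mulrC ltr_pM2l// ltrDl.
Qed.

End distribution_of_integrable.

(** * Pointwise bounds on the convolutions: local averages, and decay at infinity *)

Section maximal_bounds.
Context {R : realType} {n : nat}.
Local Notation V := 'rV[R]_n.+1.
Local Notation leb := (@lebesgue R n).
Local Notation normc := Normc.normc.
Variables (f : V -> R[i]) (phi : V -> R) (A L : R).
Hypotheses (If : cintegrable f) (A0 : 0 < A) (L0 : 0 < L)
  (cphi : continuous phi) (phi0 : forall x, 1 < `|x| -> phi x = 0)
  (phiA : forall x, `|phi x| <= A)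
  (phiL : forall x y, `|phi x - phi y| <= L * `|x - y|).
Implicit Types (x y : V) (eps : R).

Let k eps x y : R := dilate phi eps (x - y).

Let cmeasurable_k eps x (c : R) : cmeasurable (fun y => (k eps x y - c)%:C%C).
Proof.
have ck : continuous (fun y => k eps x y - c).
  move=> y; apply: continuousB; last exact: cst_continuous.
  apply: continuousM; first exact: cst_continuous.
  apply: (continuous_comp (g := phi)); last exact: cphi.
  apply: continuousZl_tmp; apply: continuousB; first exact: cst_continuous.
  exact: cvg_id.
by apply: cmeasurable_continuous; [exact: ck|exact: cst_continuous].
Qed.

Let k_bound eps x y : 0 < eps -> `|k eps x y| <= eps ^- n.+1 * A.
Proof.
move=> e0; rewrite /k /dilate normrM ger0_norm ?invr_ge0 ?exprn_ge0 ?(ltW e0)//.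
by rewrite ler_wpM2l ?invr_ge0 ?exprn_ge0 ?(ltW e0).
Qed.

(** The dilated kernel is at most [eps ^- d * A] and vanishes where [|x - y| > eps]. Balls being
    open, the radius is doubled to contain the closed ball of radius [eps]. *)
Lemma convolve_le_ball eps x : 0 < eps ->
  ((normc (convolve (distribution_of f) (dilate phi eps) x))%:E <=
   (2 * (eps ^- n.+1 * A))%:E *
     \int[leb]_(y in ball x (eps *+ 2)) (normc (f y))%:E)%E.
Proof.
move=> e0; have [mf foo] := If.
have ce0 : 0 <= eps ^- n.+1 * A by rewrite mulr_ge0 ?invr_ge0 ?exprn_ge0 ?ltW.
have mk : cmeasurable (fun y => (k eps x y)%:C%C).
  by have := cmeasurable_k eps x 0; under eq_fun do rewrite subr0.
apply: le_trans (normc_cintegral_le (cmeasurableM mf mk)) _.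
rewrite EFinM -muleA; apply: lee_wpmul2l => //.
rewrite [in leRHS]integral_mkcond -ge0_integralZl; [|exact: measurableT| |
    by move=> y _; apply: erestrict_ge0 => z _; rewrite lee_fin normc_ge0|
    by rewrite lee_fin]; last first.
  apply/(measurable_restrictT _ _).1; first exact: measurable_ball_rV.
  by apply: measurable_funTS; apply/measurable_EFinP; exact: measurable_normc.
apply: le_nnintegral => y; first by rewrite lee_fin normc_ge0.
rewrite Normc.normcM normc_real patchE.
case: ifPn => [_|/negP xy].
  by rewrite -EFinM lee_fin mulrC ler_wpM2r ?normc_ge0// k_bound.
rewrite mule0 /k /dilate phi0 ?mulr0 ?normr0 ?mulr0//.
rewrite normrZ gtr0_norm ?invr_gt0// mulrC ltr_pdivlMr// mul1r.
rewrite ltNge; apply/negP => xye; apply: xy; rewrite inE.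
by rewrite -ball_normE/=; apply: le_lt_trans xye _; rewrite mulr2n ltrDl.
Qed.

(** As [f] has mean zero, the value of the kernel at [y = 0] may be subtracted from it; the
    Lipschitz bound then gains a factor [eps^-1], and only [eps >= |x| / 2] contributes. The
    exponent [n.+2] is [d + 1]. *)
Lemma convolve_le_decay eps x : 0 < eps ->
  (forall y, f y != 0 -> `|y| <= 1) -> cintegral setT f = 0 -> 2 <= `|x| ->
  ((normc (convolve (distribution_of f) (dilate phi eps) x))%:E <=
   (2 * (L * (2 / `|x|) ^+ n.+2))%:E * \int[leb]_y (normc (f y))%:E)%E.
Proof.
move=> e0 suppf meanf x2; have [mf foo] := If.
have x0 : 0 < `|x| by apply: lt_le_trans x2.
pose c := k eps x 0.
have mk : cmeasurable (fun y => (k eps x y)%:C%C).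
  by have := cmeasurable_k eps x 0; under eq_fun do rewrite subr0.
have Ifk : cintegrable (fun y => f y * (k eps x y)%:C%C).
  by apply: cintegrableM If mk _ => y; rewrite normc_real; exact: k_bound.
have -> : convolve (distribution_of f) (dilate phi eps) x =
    cintegral setT (fun y => f y * (k eps x y - c)%:C%C).
  rewrite [RHS](_ : _ = cintegral setT
      (fun y => (- c%:C%C) * f y + f y * (k eps x y)%:C%C)).
    by rewrite cintegral_linear// meanf mulr0 add0r.
  congr cintegral; apply/funext => y.
  by rewrite rmorphB mulrBr addrC [- _ * _]mulrC mulrN.
have dpow : 0 <= L * (2 / `|x|) ^+ n.+2.
  by apply: mulr_ge0; [exact: ltW|rewrite exprn_ge0// divr_ge0].
apply: le_trans (normc_cintegral_le (cmeasurableM mf (cmeasurable_k eps x c))) _.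
rewrite EFinM -muleA; apply: lee_wpmul2l => //.
apply: integral_normcM_le => //.
move=> y; have [->|/suppf y1] := eqVneq (f y) 0.
  by rewrite mul0r Normc.normc0 mulr0.
rewrite Normc.normcM normc_real mulrC ler_wpM2r ?normc_ge0//.
(* For small [eps] both kernel values vanish, since [|x - y| >= |x| - 1 >= |x| / 2] on the support
   of [f]. *)
have [ex|xe] := ltP eps (`|x| / 2).
  have big z : `|x| / 2 <= `|z| -> phi (eps^-1 *: z) = 0.
    move=> xz; apply: phi0; rewrite normrZ gtr0_norm ?invr_gt0//.
    by rewrite mulrC ltr_pdivlMr// mul1r (lt_le_trans ex).
  rewrite /c /k /dilate subr0 !big ?subrr ?mulr0 ?subrr ?normr0//.
    by rewrite ler_pdivrMr// ler_peMr ?ler1n// ltW.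
  have := lerB_dist x y; lra.
rewrite /c /k /dilate subr0 -mulrBr normrM gtr0_norm ?invr_gt0 ?exprn_gt0//.
apply: (@le_trans _ _ (eps ^- n.+1 * (L * eps^-1))).
  apply: ler_wpM2l; first by rewrite invr_ge0 exprn_ge0// ltW.
  apply: le_trans (phiL _ _) _; rewrite ler_wpM2l ?(ltW L0)//.
  rewrite -scalerBr addrAC subrr add0r normrZ normrN gtr0_norm ?invr_gt0//.
  by rewrite ler_piMr// invr_ge0 ltW.
rewrite mulrCA -exprVn -exprSr ler_wpM2l ?(ltW L0)//.
have ei0 : 0 <= eps^-1 by rewrite invr_ge0 ltW.
rewrite lerXn2r ?nnegrE ?divr_ge0//.
by rewrite -[leRHS]invrK invf_div lef_pV2// posrE ?divr_gt0.
Qed.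

End maximal_bounds.

(** * Logarithmic sums and Psi *)

Section log_bounds.
Context {R : realType}.
Implicit Types (t : R).

(** The induction step is [1 / (N + 2) <= - ln (1 - 1 / (N + 2))], an instance of
    [ln (1 + u) <= u]. *)
Lemma harmonic_le_ln N : \sum_(0 <= k < N.+1) (k.+1%:R^-1 : R) <= 1 + ln N.+1%:R.
Proof.
elim: N => [|N IH]; first by rewrite big_nat1 invr1 ln1 addr0.
rewrite big_nat_recr//=; apply: (le_trans (lerD IH (lexx _))).
rewrite -addrA lerD2l -lerBrDl.
have N1 : 0 < N.+1%:R :> R by [].
have N2 : 0 < N.+2%:R :> R by [].
rewrite -[leRHS]opprK opprB -ln_div// lerNr.
rewrite -[X in ln X](subrKC 1); apply: le_trans (le_ln1Dx _) _.
  by rewrite ltrBrDl addrN divr_gt0.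
rewrite -[X in _ / _ - X](divff (lt0r_neq0 N2)) -mulrBl -[in X in _ - X]natr1.
by rewrite opprD addNKr mulN1r.
Qed.

(** Only indices with [k + 1 < ln t] count, so this is a harmonic sum up to [ln t]. *)
Lemma sum_levels_le_loglog (t : R) N :
  \sum_(0 <= k < N) k.+1%:R^-1 * (expR k.+1%:R < t)%R%:R <= 1 + logp (logp t).
Proof.
elim: N => [|N IH]; first by rewrite big_geq// addr_ge0// le_max lexx orbT.
(* If the last level is not below [t], its term is 0. Otherwise [N + 1 <= ln t], and all indicators
   may be replaced by 1. *)
have [eNt|/negbTE eNt] := boolP (expR N.+1%:R < t); last first.
  by rewrite big_nat_recr//= eNt mulr0 addr0.
apply: (@le_trans _ _ (\sum_(0 <= k < N.+1) (k.+1%:R^-1 : R))).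
  apply: ler_sum => k _; rewrite ler_piMr ?invr_ge0//.
  by case: (_ < _).
apply: le_trans (harmonic_le_ln N) _; rewrite lerD2l.
have t0 : 0 < t by apply: lt_trans eNt; exact: expR_gt0.
have Nlt : N.+1%:R <= ln t.
  by rewrite -[leLHS]expRK ler_ln ?posrE ?expR_gt0// ltW.
have lt0 : 0 < ln t by apply: lt_le_trans Nlt.
rewrite /logp (max_l (ltW lt0)) le_max ler_ln ?posrE//.
by rewrite Nlt.
Qed.

Context {n : nat}.
Implicit Types x : 'rV[R]_n.+1.

Lemma ln_expR1D_ge1 t : 0 <= t -> 1 <= ln (expR 1 + t).
Proof.
move=> t0; rewrite -[leLHS]expRK ler_ln ?posrE ?expR_gt0 ?lerDl//.
by rewrite ltr_wpDr// expR_gt0.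
Qed.

Lemma Psi_denom_ge x t : ln (expR 1 + t) <= ln (expR 1 + t) + ln (expR 1 + enorm x).
Proof. by rewrite lerDl (le_trans ler01)// ln_expR1D_ge1// sqrtr_ge0. Qed.

(** The term [ln (e + |x|)] of the denominator is nonnegative and is dropped; the gain [1 / c] is
    what produces the double logarithm. *)
Lemma Psi_le_log x t (c : R) : 0 <= t -> 0 < c -> expR c <= expR 1 + t ->
  Psi x t <= t / c.
Proof.
move=> t0 c0 ct; rewrite /Psi ler_wpM2l//.
have lc : c <= ln (expR 1 + t).
  by rewrite -[leLHS]expRK ler_ln ?posrE ?expR_gt0// ltr_wpDr// expR_gt0.
rewrite lef_pV2 ?posrE//; last first.
  by apply: lt_le_trans (Psi_denom_ge x t); exact: lt_le_trans lc.
exact: le_trans lc (Psi_denom_ge x t).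
Qed.

Lemma Psi_le x t : 0 <= t -> Psi x t <= t.
Proof. by move=> t0; rewrite -[leRHS]divr1 Psi_le_log// lerDl. Qed.

Lemma Psi_ge0 x t : 0 <= t -> 0 <= Psi x t.
Proof.
move=> t0; rewrite /Psi divr_ge0//; apply: le_trans (Psi_denom_ge x t).
exact: le_trans ler01 (ln_expR1D_ge1 t0).
Qed.

Lemma ePsi_le x (t : \bar R) : (0 <= t -> ePsi x t <= t)%E.
Proof. by case: t => [t||]//; rewrite !lee_fin; exact: Psi_le. Qed.

Lemma ePsi_ge0 x (t : \bar R) : (0 <= t -> 0 <= ePsi x t)%E.
Proof. by case: t => [t||]//; rewrite !lee_fin; exact: Psi_ge0. Qed.

End log_bounds.

(** * Integrability of Psi (x, M_phi f (x)) *)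

Section domination.
Context {R : realType} {n : nat}.
Local Notation V := 'rV[R]_n.+1.
Local Notation leb := (@lebesgue R n).
Local Notation normc := Normc.normc.

Lemma measurable_logp_comp (u : lebesgue_space R n -> R) : measurable_fun setT u ->
  measurable_fun setT (fun x => logp (u x)).
Proof.
move=> mu; rewrite (_ : (fun _ => _) = (@ln R \o u) \max cst 0); last by [].
apply: measurable_maxr; last exact: measurable_cst.
by apply: measurableT_comp mu; exact: measurable_ln.
Qed.

Lemma measurable_scaled_indic (c : R) (E : set (lebesgue_space R n)) :
  measurable E ->
  measurable_fun [set: lebesgue_space R n] (fun x => (c * \1_E x)%:E).
Proof.
by move=> mE; apply/measurable_EFinP; apply: measurable_funM.
Qed.

Lemma integral_scaled_indic (c : R) (E : set (lebesgue_space R n)) :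
  measurable E -> 0 <= c ->
  (\int[leb]_x (c * \1_E x)%:E = c%:E * leb E)%E.
Proof.
move=> mE c0; under eq_integral do rewrite EFinM.
rewrite ge0_integralZl; [|exact: measurableT|
  by apply/measurable_EFinP; exact: measurable_indic|by []|by rewrite lee_fin].
by rewrite integral_indic// setIT.
Qed.

(** Termwise integration, shared by the level sets near the support and the dyadic cubes far from
    it. *)
Lemma integral_sum_indic_lt (c : nat -> R) (E : nat -> set (lebesgue_space R n))
    (u : nat -> \bar R) : (forall k, measurable (E k)) -> (forall k, 0 <= c k) ->
  (forall k, (c k)%:E * leb (E k) <= u k)%E -> (\sum_(0 <= k <oo) u k < +oo)%E ->
  (\int[leb]_x \sum_(0 <= k <oo) (c k * \1_(E k) x)%:E < +oo)%E.
Proof.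
move=> mE c0 cu; apply: le_lt_trans.
rewrite integral_nneseries; [|exact: measurableT|
  by move=> k; exact: measurable_scaled_indic|
  by move=> k x _; rewrite lee_fin mulr_ge0].
apply: lee_nneseries => [k _ _|k _]; last by rewrite integral_scaled_indic.
by apply: integral_ge0 => x _; rewrite lee_fin mulr_ge0.
Qed.

Variables (f : V -> R[i]) (phi : V -> R) (A L : R).
Hypotheses (If : cintegrable f) (A0 : 0 < A) (L0 : 0 < L)
  (cphi : continuous phi) (phi0 : forall x, 1 < `|x| -> phi x = 0)
  (phiA : forall x, `|phi x| <= A)
  (phiL : forall x y, `|phi x - phi y| <= L * `|x - y|).

Let g (x : lebesgue_space R n) : R := normc (f x).
Let M := maximal phi (distribution_of f).

Let g0 x : 0 <= g x. Proof. exact: normc_ge0. Qed.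

Let mg : measurable_fun setT g.
Proof. by case: If => mf _; exact: measurable_normc. Qed.

Definition high (k : nat) (x : lebesgue_space R n) : R :=
  g x * (expR k%:R < g x)%R%:R.

Lemma high_ge0 k x : 0 <= high k x.
Proof. by rewrite mulr_ge0. Qed.

Lemma measurable_high k : measurable_fun setT (high k).
Proof.
rewrite (_ : high k = g \* \1_(g @^-1` `]expR k%:R, +oo[)).
  apply: measurable_funM; [exact: mg|apply: measurable_indic].
  by rewrite -[X in measurable X]setTI; exact: mg.
apply/funext => x; rewrite /high /= indicE; congr (_ * _).
rewrite (_ : (x \in _) = (expR k%:R < g x))//.
by apply/idP/idP; rewrite inE/= in_itv/= andbT.
Qed.

Lemma maximal_ge0 x : (0 <= M x)%E.
Proof.
apply: (@le_trans _ _ (normc (convolve (distribution_of f) (dilate phi 1) x))%:E).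
  by rewrite lee_fin normc_ge0.
by apply: ereal_sup_ubound; exists 1 => //=.
Qed.

(* On a ball of radius 2 eps the part of |f| above expR k contributes 2^d by
   the weak-type bound, the rest 4^d by the volume; the 1 only ensures
   level_const >= 1. *)
Definition level_const : R := 2 * A * (2 ^+ n.+1 + 4 ^+ n.+1) + 1.

(** The weak-type bound for [high k] at height [e^k]. Off [E] it controls all cube averages of
    [|f|], and [convolve_le_ball] passes from averages to the maximal function. *)
Lemma maximal_level (k : nat) : exists E : set (lebesgue_space R n),
  [/\ measurable E,
      ((expR k%:R)%:E * leb E <=
        (18 ^+ n.+1)%:E * \int[leb]_x (high k x)%:E)%E &
      forall x, ~ E x -> (M x <= (level_const * expR k%:R)%:E)%E].
Proof.
have ek0 : 0 < expR k%:R :> R by exact: expR_gt0.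
have h0 x : (0 <= (EFin \o high k) x)%E by rewrite lee_fin high_ge0.
have mh : measurable_fun setT (EFin \o high k).
  by apply/measurable_EFinP; exact: measurable_high.
have [E [mE lE hE]] := weak_type h0 mh ek0.
exists E; split => // x Ex; apply: ge_ereal_sup => _ [eps /= e0 <-].
apply: le_trans (convolve_le_ball If A0 cphi phi0 phiA x e0) _.
set B := ball x (eps *+ 2).
have mB : measurable (B : set (lebesgue_space R n)) by exact: measurable_ball_rV.
have e20 : 0 < eps *+ 2 by rewrite pmulrn_lgt0.
have hB : (\int[leb]_(y in B) (normc (f y))%:E <=
    (expR k%:R * (2 ^+ n.+1 + 4 ^+ n.+1) * eps ^+ n.+1)%:E)%E.
  (* Pointwise [|f| <= high k + e^k]: weak type handles the first summand, the volume of the cube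
     the second. *)
  apply: (@le_trans _ _ (\int[leb]_(y in B) ((high k y)%:E + (expR k%:R)%:E))%E).
    apply: ge0_le_integral; first exact: mB.
    - by move=> y _; rewrite lee_fin normc_ge0.
    - by apply: measurable_funTS; apply/measurable_EFinP; exact: mg.
    - by apply: measurable_funTS; apply: emeasurable_funD => //; exact: mh.
    - move=> y _; rewrite -EFinD lee_fin /high -/(g y).
      case: ltP => [_|gy]; first by rewrite mulr1 lerDl ltW.
      by rewrite mulr0 add0r.
  rewrite ge0_integralD; [|exact: mB|by move=> y _; exact: h0|
    by apply: measurable_funTS; exact: mh|by move=> y _; rewrite lee_fin ltW|
    exact: measurable_cst].
  rewrite mulrDr mulrDl EFinD; apply: leeD.
    apply: le_trans (hE x _ Ex e20) _.
    by rewrite lee_fin -[eps *+ 2]mulr_natl exprMn mulrA.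
  rewrite integral_cst//= -mulrA EFinM; apply: lee_wpmul2l; first by rewrite lee_fin ltW.
  apply: le_trans (lebesgue_ball_le _ (ltW e20)) _.
  by rewrite lee_fin -mulrnA -[eps *+ _]mulr_natl exprMn.
have c0 : 0 <= 2 * (eps ^- n.+1 * A).
  by rewrite mulr_ge0// mulr_ge0 ?(ltW A0)// invr_ge0 exprn_ge0// ltW.
apply: le_trans (lee_wpmul2l _ hB) _; first by rewrite lee_fin.
have en0 : eps ^+ n.+1 != 0 by rewrite expf_neq0// gt_eqF.
set S := 2 ^+ n.+1 + _; rewrite -EFinM lee_fin.
rewrite [leLHS](_ : _ = 2 * A * S * expR k%:R * (eps ^- n.+1 * eps ^+ n.+1)).
  by rewrite mulVf// mulr1 /level_const -/S [leRHS]mulrDl mul1r lerDl ltW.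
by ring.
Qed.

Hypothesis g_loglog : (\int[leb]_x (g x * logp (logp (g x)))%:E < +oo)%E.

(** Summed under the integral, the weights give [|f|] times the sum of [1 / (k + 1)] over
    [e^(k + 1) < |f|], hence at most [|f| (1 + log log |f|)]; here the L log log L hypothesis
    enters. *)
Lemma sum_integral_high_lt :
  (\sum_(0 <= k <oo) \int[leb]_x (k.+1%:R^-1 * high k.+1 x)%:E < +oo)%E.
Proof.
have h0 k x : (0 <= (k.+1%:R^-1 * high k.+1 x)%:E)%E.
  by rewrite lee_fin mulr_ge0// high_ge0.
have mh k : measurable_fun setT (fun x => (k.+1%:R^-1 * high k.+1 x)%:E).
  apply/measurable_EFinP; apply: measurable_funM; first exact: measurable_cst.
  exact: measurable_high.
rewrite -integral_nneseries//.
have mgl : measurable_fun setT (fun x => g x * logp (logp (g x))).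
  by apply: measurable_funM; [exact: mg|do 2 apply: measurable_logp_comp; exact: mg].
apply: (@le_lt_trans _ _ (\int[leb]_x ((g x)%:E + (g x * logp (logp (g x)))%:E))%E).
  apply: le_nnintegral => x; first exact: nneseries_ge0.
  apply: lime_le; first exact: is_cvg_nneseries.
  apply: nearW => N; rewrite sumEFin -EFinD lee_fin.
  rewrite -[X in X + _]mulr1 -mulrDr.
  apply: le_trans (ler_wpM2l (g0 x) (sum_levels_le_loglog (g x) N)).
  by rewrite mulr_sumr; apply: ler_sum => k _; rewrite /high mulrCA.
have mgE : measurable_fun setT (EFin \o g) by apply/measurable_EFinP; exact: mg.
have mglE := (measurable_EFinP _ _).2 mgl.
have gl0 x : (0 <= (g x * logp (logp (g x)))%:E)%E.
  by rewrite lee_fin mulr_ge0// le_max lexx orbT.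
have gE0 x : (0 <= (g x)%:E)%E by rewrite lee_fin.
rewrite ge0_integralD; [|exact: measurableT|by move=> x _; exact: gE0|exact: mgE|
  by move=> x _; exact: gl0|exact: mglE].
by rewrite lte_add_pinfty//; case: If.
Qed.

Let level_const_ge1 : 1 <= level_const.
Proof. by rewrite lerDr mulr_ge0 ?addr_ge0 ?exprn_ge0// mulr_ge0// ltW. Qed.

(** Bounds [Psi x t] for [t] between [level_const * e^(k + 1)] and [level_const * e^(k + 2)]. *)
Let near_coef (k : nat) : R := level_const * expR k.+2%:R / k.+1%:R.

(** Besides positivity, this makes the series of [ePsi_near] diverge at a point lying in every
    [E k]. *)
Let near_coef_ge1 k : 1 <= near_coef k.
Proof.
rewrite /near_coef -[leLHS]mul1r -mulrA ler_pM//.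
rewrite ler_pdivlMr// mul1r (le_trans _ (expR_ge1Dx _))//.
by rewrite nat1r ler_nat leqW.
Qed.

(** If the least level bounding [M x] is [k + 2], then [x] lies in [E k], and the [k]-th term alone
    dominates; levels 0 and 1 are absorbed by the constant. *)
Lemma ePsi_near (E : nat -> set (lebesgue_space R n)) x :
  (forall k, ~ E k x -> (M x <= (level_const * expR k.+1%:R)%:E)%E) ->
  (ePsi x (M x) <= (level_const * expR 1)%:E +
    \sum_(0 <= k <oo) (near_coef k * \1_(E k) x)%:E)%E.
Proof.
move=> hE.
have t0 k : (0 <= (near_coef k * \1_(E k) x)%:E)%E.
  by rewrite lee_fin mulr_ge0// (le_trans ler01).
have S0 : (0 <= \sum_(0 <= k <oo) (near_coef k * \1_(E k) x)%:E)%E.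
  exact: nneseries_ge0.
have lc0 : 0 <= level_const * expR 1.
  by rewrite mulr_ge0 ?expR_ge0// (le_trans ler01).
case Mx : (M x) => [m| |]; last first.
- by have := maximal_ge0 x; rewrite Mx.
(* If [M x = +oo], then [x] lies in every [E k] and each term is at least 1, so some partial sum
   exceeds any supposed finite value of the series. *)
- have Ex k : E k x.
    by apply: contrapT => /hE; rewrite Mx.
  rewrite (_ : \sum_(0 <= k <oo) _ = +oo)%E ?addey//.
  apply/eqP; rewrite -leye_eq leNgt; apply/negP => Soo.
  have SE : (\sum_(0 <= k <oo) (near_coef k * \1_(E k) x)%:E)%E \is a fin_num.
    by rewrite ge0_fin_numE.
  have := nneseries_lim_ge (P := xpredT) (m := 0%N)
    (Num.bound (fine (\sum_(0 <= k <oo) (near_coef k * \1_(E k) x)%:E)%E))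
    (fun k _ _ => t0 k).
  rewrite -[leRHS]fineK// sumEFin lee_fin; apply/negP; rewrite -ltNge.
  apply: lt_le_trans (archi_boundP _) _; first exact: fine_ge0.
  set N := Num.bound _; rewrite -[leLHS]mulr1 -[X in X%:R * _](subn0 N).
  rewrite mulr_natl -sumr_const_nat; apply: ler_sum => k _.
  by rewrite indicE mem_set// mulr1.
have m0 : 0 <= m by have := maximal_ge0 x; rewrite Mx lee_fin.
have Pm : (ePsi x m%:E <= m%:E)%E by rewrite ePsi_le.
have exk : exists k, m <= level_const * expR k%:R.
  exists (Num.bound m); apply: le_trans (ltW (archi_boundP m0)) _.
  rewrite -[leLHS]mul1r ler_pM//.
  by apply: le_trans (expR_ge1Dx _); rewrite lerDr.
case: (ex_minnP exk) => [[|[|k]] mk kmin].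
- apply: le_trans Pm _; rewrite -[leLHS]adde0; apply: leeD => //.
  rewrite lee_fin; apply: (le_trans mk); rewrite ler_wpM2l//.
    exact: le_trans ler01 _.
  by rewrite ler_expR.
- apply: le_trans Pm _; rewrite -[leLHS]adde0; apply: leeD => //.
have mk1 : level_const * expR k.+1%:R < m.
  by rewrite ltNge; apply/negP => /kmin; rewrite ltnn.
have Ekx : E k x.
  by apply: contrapT => /hE; rewrite Mx lee_fin leNgt mk1.
rewrite -[leLHS]add0e; apply: leeD; first by rewrite lee_fin.
apply: (@le_trans _ _ (near_coef k * \1_(E k) x)%:E); last first.
  rewrite (@nneseriesD1 _ _ k)//; apply: leeDl.
  exact: nneseries_ge0.
rewrite indicE mem_set// mulr1 lee_fin.
(* Minimality of the level and [level_const >= 1] give [e^(k + 1) < m], as [Psi_le_log] requires. *)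
apply: le_trans (Psi_le_log x m0 (_ : 0 < k.+1%:R) _) _ => //.
  apply: (le_trans _ (ltW (lt_le_trans mk1 _))); last by rewrite lerDr expR_ge0.
  by rewrite ler_peMl// expR_ge0.
by rewrite ler_wpM2r.
Qed.

Hypotheses (suppf : forall y, f y != 0 -> `|y| <= 1)
  (meanf : cintegral setT f = 0).

Let I : R := fine (\int[leb]_y (normc (f y))%:E)%E.

(** The bound of [convolve_le_decay] on the shell [2^(k + 1) <= |x| < 2^(k + 2)], where
    [2 / |x| <= 2^-k]. *)
Let far_coef (k : nat) : R := 2 * (L * (2 ^- k) ^+ n.+2) * I.

Let I0 : 0 <= I.
Proof. by apply: fine_ge0; apply: integral_ge0 => x _; rewrite lee_fin normc_ge0. Qed.

Let far_coef_ge0 k : 0 <= far_coef k.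
Proof.
by rewrite /far_coef mulr_ge0// mulr_ge0// mulr_ge0 ?(ltW L0).
Qed.

Lemma ePsi_far x : 2 <= `|x| ->
  (ePsi x (M x) <=
    \sum_(0 <= k <oo) (far_coef k * \1_(ball (0 : V) (2 ^+ k.+2)) x)%:E)%E.
Proof.
move=> x2; apply: le_trans (ePsi_le x (maximal_ge0 x)) _.
have exk : exists k, `|x| < 2 ^+ k.+2.
  exists (Num.bound `|x|); apply: lt_le_trans (archi_boundP (normr_ge0 x)) _.
  rewrite -natrX ler_nat (leq_trans (ltnW (ltn_expl _ (ltnSn 1))))//.
  by rewrite leq_exp2l// leqW.
case: (ex_minnP exk) => k xk kmin.
(* Minimality of [k] gives the inner radius of the shell; for [k = 0] it is the hypothesis
   [2 <= |x|]. *)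
have kx : 2 ^+ k.+1 <= `|x|.
  case: k kmin {xk} => [|k] kmin; first by rewrite expr1.
  by rewrite leNgt; apply/negP => /kmin; rewrite ltnn.
have x0 : 0 < `|x| by apply: lt_le_trans x2.
apply: (@le_trans _ _ (far_coef k * \1_(ball (0 : V) (2 ^+ k.+2)) x)%:E); last first.
  rewrite (@nneseriesD1 _ _ k)//; last by move=> j _; rewrite lee_fin mulr_ge0.
  by apply: leeDl; apply: nneseries_ge0 => j _ _; rewrite lee_fin mulr_ge0.
rewrite indicE mem_set; last by rewrite -ball_normE/= sub0r normrN.
rewrite mulr1; apply: ge_ereal_sup => _ [eps /= e0 <-].
apply: le_trans (convolve_le_decay If L0 cphi phi0 phiA phiL e0 suppf meanf x2) _.
have [_ foo] := If.
rewrite -[X in (_ * X)%E]fineK; last first.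
  by rewrite ge0_fin_numE//; apply: integral_ge0 => y _; rewrite lee_fin normc_ge0.
rewrite -EFinM lee_fin /far_coef ler_wpM2r// ler_wpM2l// ler_wpM2l ?(ltW L0)//.
rewrite lerXn2r ?nnegrE ?invr_ge0 ?exprn_ge0 ?divr_ge0//.
by rewrite ler_pdivrMr// ler_pdivlMl ?exprn_gt0// -exprSr.
Qed.

(** Three integrable majorants: a constant on the cube of radius 2 ([S0]), the level sets ([S1]) and
    the dyadic cubes ([S2]). *)
Lemma integral_ePsi_maximal_lt : (\int[leb]_x ePsi x (M x) < +oo)%E.
Proof.
have [E hE] := choice (fun k => maximal_level k.+1).
have mE k : measurable (E k) by have [] := hE k.
pose F (k : nat) : set (lebesgue_space R n) := ball (0 : V) (2 ^+ k.+2).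
have mF k : measurable (F k) by exact: measurable_ball_rV.
pose Q : set (lebesgue_space R n) := ball (0 : V) 2.
have mQ : measurable Q by exact: measurable_ball_rV.
pose c := level_const * expR 1.
have lc0 : 0 <= level_const by exact: le_trans level_const_ge1.
have c0 : 0 <= c by rewrite mulr_ge0// expR_ge0.
have near_coef_ge0 k : 0 <= near_coef k by exact: le_trans (near_coef_ge1 k).
pose S0 x := (c * \1_Q x)%:E.
pose S1 x := (\sum_(0 <= k <oo) (near_coef k * \1_(E k) x)%:E)%E.
pose S2 x := (\sum_(0 <= k <oo) (far_coef k * \1_(F k) x)%:E)%E.
have S00 x : (0 <= S0 x)%E by rewrite lee_fin mulr_ge0.
have S10 x : (0 <= S1 x)%E by apply: nneseries_ge0 => k _ _; rewrite lee_fin mulr_ge0.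
have S20 x : (0 <= S2 x)%E by apply: nneseries_ge0 => k _ _; rewrite lee_fin mulr_ge0.
have mS0 : measurable_fun setT S0 by exact: measurable_scaled_indic.
have mS1 : measurable_fun setT S1.
  apply: ge0_emeasurable_sum => [k x _ _|k _]; first by rewrite lee_fin mulr_ge0.
  exact: measurable_scaled_indic.
have mS2 : measurable_fun setT S2.
  apply: ge0_emeasurable_sum => [k x _ _|k _]; first by rewrite lee_fin mulr_ge0.
  exact: measurable_scaled_indic.
have IS0 : (\int[leb]_x S0 x < +oo)%E.
  rewrite integral_scaled_indic//.
  apply: (@le_lt_trans _ _ (c%:E * ((2 *+ 2) ^+ n.+1)%:E)%E).
    by apply: lee_wpmul2l; rewrite ?lee_fin//; exact: lebesgue_ball_le.
  by rewrite -EFinM ltry.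
have IS1 : (\int[leb]_x S1 x < +oo)%E.
  (* The factor [e^(k + 1)] of [near_coef k] cancels against the measure of [E k], leaving
     [c / (k + 1)] times the weak-type constant [18 ^ d]. *)
  pose C := c * 18 ^+ n.+1.
  apply: (integral_sum_indic_lt (u := fun k =>
      C%:E * \int[leb]_x (k.+1%:R^-1 * high k.+1 x)%:E)%E) => //.
    move=> k; have [_ lE _] := hE k.
    rewrite (_ : near_coef k = c * k.+1%:R^-1 * expR k.+1%:R); last first.
      by rewrite /near_coef /c -natr1 addrC expRD; ring.
    rewrite EFinM -muleA; apply: le_trans (lee_wpmul2l _ lE) _.
      by rewrite lee_fin mulr_ge0.
    under [in leRHS]eq_integral do rewrite EFinM.
    rewrite ge0_integralZl; [|exact: measurableT| | |].
    - by rewrite !muleA -!EFinM /C mulrAC.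
    - by apply/measurable_EFinP; exact: measurable_high.
    - by move=> x _; rewrite lee_fin high_ge0.
    - by rewrite lee_fin.
  rewrite nneseriesZl; last first.
    move=> k _; apply: integral_ge0 => x _.
    by rewrite lee_fin mulr_ge0// high_ge0.
  apply: lte_mul_pinfty => //; last exact: sum_integral_high_lt.
  by rewrite lee_fin mulr_ge0// exprn_ge0.
have IS2 : (\int[leb]_x S2 x < +oo)%E.
  (* The cube has side [8 * 2^k] and [far_coef k] is [2 L I 2^(-k (d + 1))]; the product is
     [e / 2^(k + 1)], a geometric series. *)
  pose e : R := 4 * L * I * 8 ^+ n.+1.
  have e0 : 0 <= e by rewrite mulr_ge0 ?exprn_ge0// mulr_ge0// mulr_ge0// ltW.
  apply: (integral_sum_indic_lt (u := fun k => (e / (2 ^ k.+1)%:R)%:E)) => //.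
    move=> k; apply: le_trans (lee_wpmul2l _ (lebesgue_ball_le _ _)) _.
    - by rewrite lee_fin.
    - by rewrite exprn_ge0.
    rewrite -EFinM lee_fin /far_coef /e natrX.
    set z : R := 2 ^+ k.
    have z0 : z != 0 by rewrite expf_neq0.
    rewrite (_ : 2 ^+ k.+2 *+ 2 = 8 * z); last by rewrite !exprS /z; ring.
    rewrite [2 ^+ k.+1]exprS -/z invfM exprMn !exprS exprVn.
    have zn0 : z ^+ n != 0 by rewrite expf_neq0.
    by rewrite le_eqVlt; apply/orP; left; apply/eqP; field; rewrite z0.
  by apply: le_lt_trans (epsilon_trick0 xpredT e0) _; rewrite ltry.
apply: (@le_lt_trans _ _ (\int[leb]_x (S0 x + S1 x + S2 x))%E).
  apply: le_nnintegral => x; first by rewrite ePsi_ge0// maximal_ge0.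
  have [x2|x2] := leP 2 `|(x : V)|.
    apply: le_trans (ePsi_far x2) _; apply: leeDr; exact: adde_ge0.
  rewrite -[leLHS]adde0; apply: leeD => //.
  rewrite /S0 indicE mem_set ?mulr1; last by rewrite /Q -ball_normE/= sub0r normrN.
  by apply: ePsi_near => k Ek; have [_ _] := hE k; exact.
have S010 x : (0 <= S0 x + S1 x)%E by exact: adde_ge0.
have mS01 := emeasurable_funD mS0 mS1.
have IS01 := integralD_lty S00 S10 mS0 mS1 IS0 IS1.
exact: integralD_lty S010 S20 mS01 mS2 IS01 IS2.
Qed.

End domination.

(** * From integrals over the ball to integrals over the whole space *)

Theorem theorem3 (R : realType) (n : nat) (phi : 'rV[R]_n.+1 -> R)
    (phi_admissible : admissible_kernel phi)
    (f : 'rV[R]_n.+1 -> R[i])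
    (f_measurable : cmeasurable f)
    (f_LloglogL : LloglogL unit_ball f)
    (f_mean0 : cintegral unit_ball f = 0) :
  Hlog phi (distribution_of f).
Proof.
have [[_ f_loc] suppf loglogf] := f_LloglogL.
have suppB x : f x != 0 -> unit_ball x.
  by move=> fx; apply: suppf; exact: subset_closure.
have suppQ x : f x != 0 -> `|x| <= 1.
  by move=> /suppB; exact: le_trans (enorm_ge_norm x).
(* An integrand vanishing with [f] is unchanged by restriction to a set containing the points where
   [f] is nonzero, so integrals over the cube or the ball equal integrals over the whole space. *)
have restr (T : Type) (z : T) (u : 'rV[R]_n.+1 -> T) (D : set 'rV[R]_n.+1) :
    (forall x, f x = 0 -> u x = z) -> (forall x, f x != 0 -> D x) ->
    (fun x => if x \in D then u x else z) = u.
  move=> u0 fD; apply/funext => x; case: ifPn => // /negP xD.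
  by have [/u0//|/fD/mem_set//] := eqVneq (f x) 0.
have If : cintegrable f.
  split=> //; have := f_loc _ (@compact_unit_cube R n).
  rewrite integral_mkcond /patch restr// => x ->.
  by rewrite Normc.normc0.
have loglog : (\int[@lebesgue R n]_x (Normc.normc (f x) *
    logp (logp (Normc.normc (f x))))%:E < +oo)%E.
  move: loglogf; rewrite integral_mkcond /patch restr// => x ->.
  by rewrite Normc.normc0 mul0r.
have mean : cintegral setT f = 0.
  rewrite -f_mean0 /cintegral.
  congr Complex; rewrite [RHS]Rintegral_mkcond /patch restr// => x /= ->//.
split; first exact: tempered_distribution_of.
have [A A0 [L L0 [cphi phi0 phiA phiL]]] := admissible_kernel_bounds phi_admissible.
exact: integral_ePsi_maximal_lt If A0 L0 cphi phi0 phiA phiL loglog suppQ mean.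
Qed.
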